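(* Let $p\in\{2,3\}$, let $n$ be a positive integer, and let $P\subset \mathbb{F}_p^n\times\mathbb{F}_p^n$ be a transverse set such that for every $x\in\mathbb{F}_p^n$ the fiber $P_{x\cdot}$ contains a hyperplane of $\mathbb{F}_p^n$. Then $P$ is bilinear.
   Context: For $A\subset \mathbb{F}_p^n\times\mathbb{F}_p^n$ define the vertical sum $A\stackrel{V}{+}A=\{(x,y_1+y_2):(x,y_1),(x,y_2)\in A\}$ and the horizontal sum $A\stackrel{H}{+}A=\{(x_1+x_2,y):(x_1,y),(x_2,y)\in A\}$. The set $A$ is called transverse if $A\stackrel{V}{+}A=A\stackrel{H}{+}A=A$. The set $A$ is called bilinear if there exist linear subspaces $W_1,W_2\subseteq\mathbb{F}_p^n$, an integer $r\ge 0$ and bilinear forms $Q_1,\dots,Q_r$ on $W_1\times W_2$ such that $A=\{(x,y)\in W_1\times W_2: Q_1(x,y)=\cdots=Q_r(x,y)=0\}$. For $x\in\mathbb{F}_p^n$, the vertical fiber is $P_{x\cdot}=\{y\in\mathbb{F}_p^n:(x,y)\in P\}$. A hyperplane is a linear subspace of codimension 1. *)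

(* Defs.v *)
From HB Require Import structures.
From mathcomp Require Import all_boot all_order all_algebra.

Set Implicit Arguments.
Unset Strict Implicit.
Unset Printing Implicit Defensive.

Import GRing.Theory.
Local Open Scope ring_scope.

(* The type 'F_p has p elements only when p is prime. *)

Definition vertical_sum (p n : nat) (A : {set 'rV['F_p]_n * 'rV['F_p]_n}) :
    {set 'rV['F_p]_n * 'rV['F_p]_n} :=
  [set (u.1, u.2 + v.2) | u in A, v in A & u.1 == v.1].

Definition horizontal_sum (p n : nat) (A : {set 'rV['F_p]_n * 'rV['F_p]_n}) :
    {set 'rV['F_p]_n * 'rV['F_p]_n} :=
  [set (u.1 + v.1, u.2) | u in A, v in A & u.2 == v.2].

Definition transverse (p n : nat) (A : {set 'rV['F_p]_n * 'rV['F_p]_n}) : Prop :=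
  vertical_sum A = A /\ horizontal_sum A = A.

(* A point of W, seen in the ambient space, is sent by [vsproj W] to the
   corresponding element of the subtype [subvs_of W]; the conditions on
   membership in W1 and W2 discard the values of [vsproj] elsewhere. *)
Definition bilinear_set (p n : nat) (A : {set 'rV['F_p]_n * 'rV['F_p]_n}) : Prop :=
  exists (W1 W2 : {vspace 'rV['F_p]_n}) (r : nat)
         (Q : 'I_r ->
              {bilinear (subvs_of W1) -> (subvs_of W2) -> 'F_p | *%R & *%R}),
    A = [set z | [&& z.1 \in W1, z.2 \in W2 &
                  [forall i, Q i (vsproj W1 z.1) (vsproj W2 z.2) == 0]]].

Definition vertical_fiber (p n : nat) (A : {set 'rV['F_p]_n * 'rV['F_p]_n})
    (x : 'rV['F_p]_n) : {set 'rV['F_p]_n} :=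
  [set y | (x, y) \in A].

Definition hyperplane (p n : nat) (H : {vspace 'rV['F_p]_n}) : Prop :=
  (\dim H + 1)%N = \dim {: 'rV['F_p]_n}.

(* Main.v *)
From HB Require Import structures.
Require Import Defs.
From mathcomp Require Import all_boot all_order all_algebra.
From mathcomp Require Import ring.

(** Every fiber $P_x$ is closed under addition, so it is a linear subspace
containing a hyperplane, that is, the kernel of a linear form $f(x)$, possibly
zero and unique up to a scalar. The proof rectifies the map $f$: it has to be
shown that $f$ can be chosen linear, or that all the $f(x)$ lie on one line.

If some $(0,y)$ is not in $P$, every horizontal fiber that is nonempty contains
0, which forces $P_x \subseteq P_0 \ne V$ for all $x$. Then all fibers equal
the hyperplane $P_0$, and $P = V \times P_0$.

Otherwise all horizontal fibers $P^y = \{x : f(x)(y) = 0\}$ are subspaces.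
By duality this says that $f(ax+bx')$ is always a combination of $f(x)$ and
$f(x')$ ([transverse_forms_span]). If all the $f(x)$ are multiples of one form
$g$, then $P$ is the set where $g(y) = 0$ or $x$ lies in the subspace
$K = \{f = 0\}$, and it is cut out by the products of $g$ with linear forms
that define $K$ ([transverse_forms_rank1]).

In the remaining case, the fact that every nonzero scalar is 1 or -1 is essential
at two points. First, it implies that $P^y$ has codimension at most 1: if neither
$f(x)$ nor $f(x')$ kills $y$, one of $f(x \pm x')$ does ([transverse_forms_meet]
and [transverse_forms_hyperplane]). Fix $y_0$ and $z$ with $f(z)(y_0) \ne 0$, so
that $V = P^{y_0} \oplus \langle z\rangle$, and for $m \in P^{y_0}$ scale
$f(m+z)$ to take the value 1 at $y_0$; call the result $g(m)$. Then
$f(m-m')$ is a combination of $g(m)$ and $g(m')$ that vanishes at $y_0$, hence a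
multiple of $g(m) - g(m')$. So $N(m) = g(m) - g(0)$ is proportional to $f(m)$ and
satisfies $N(m-m') = \pm(N(m)-N(m'))$. Second, over such a field this last
relation implies that $N$ is additive ([subr_morph_up_to_sign]), and
$m + cz \mapsto N(m) + c\,g(0)$ is the linear choice of $f$
([transverse_forms_linear]). *)

Set Implicit Arguments.
Unset Strict Implicit.
Unset Printing Implicit Defensive.

Import GRing.Theory.
Local Open Scope ring_scope.

(** * The standard pairing and duality *)

Definition dot (F : fieldType) n (u v : 'rV[F]_n) : F := (u *m v^T) 0 0.

Lemma dotDl (F : fieldType) n (u v w : 'rV[F]_n) :
  dot (u + v) w = dot u w + dot v w.
Proof. by rewrite /dot mulmxDl mxE. Qed.

Lemma dotZl (F : fieldType) n a (u w : 'rV[F]_n) : dot (a *: u) w = a * dot u w.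
Proof. by rewrite /dot -scalemxAl mxE. Qed.

Lemma dotC (F : fieldType) n (u v : 'rV[F]_n) : dot u v = dot v u.
Proof. by rewrite /dot -[u *m _]trmxK trmx_mul trmxK mxE. Qed.

Lemma dotDr (F : fieldType) n (u v w : 'rV[F]_n) :
  dot u (v + w) = dot u v + dot u w.
Proof. by rewrite dotC dotDl !(dotC u). Qed.

Lemma dotZr (F : fieldType) n a (u w : 'rV[F]_n) : dot u (a *: w) = a * dot u w.
Proof. by rewrite dotC dotZl dotC. Qed.

Lemma dotBl (F : fieldType) n (u v w : 'rV[F]_n) :
  dot (u - v) w = dot u w - dot v w.
Proof. by rewrite -scaleN1r dotDl dotZl mulN1r. Qed.

Lemma dotBr (F : fieldType) n (u v w : 'rV[F]_n) :
  dot u (v - w) = dot u v - dot u w.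
Proof. by rewrite dotC dotBl !(dotC u). Qed.

Lemma dot0l (F : fieldType) n (v : 'rV[F]_n) : dot 0 v = 0.
Proof. by rewrite /dot mul0mx mxE. Qed.

Lemma dot_eq0 (F : fieldType) n (u v : 'rV[F]_n) :
  (dot u v == 0) = (u *m v^T == 0).
Proof.
apply/eqP/eqP => [uv0 | uv0]; last by rewrite /dot uv0 mxE.
by apply/rowP => i; rewrite !ord1 [RHS]mxE.
Qed.

Lemma dot_row (F : fieldType) n m (C : 'M[F]_(n, m)) (v : 'rV[F]_n) j :
  dot (row j C^T) v = (v *m C) 0 j.
Proof. by rewrite /dot -row_mul mxE -trmx_mul mxE. Qed.

Lemma dot_nondegenerate (F : fieldType) n (u : 'rV[F]_n) :
  u != 0 -> exists y, dot u y != 0.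
Proof.
move=> /rV0Pn[j uj]; exists (delta_mx 0 j).
by rewrite dotC /dot -rowE !mxE.
Qed.

(** A subspace given by a predicate is the row space of the matrix that lists
its elements, and the cokernel of that matrix supplies the equations. *)
Lemma submod_kermx (F : finFieldType) n (S : {pred 'rV[F]_n}) :
  GRing.submod_closed S ->
  exists C : 'M[F]_n, forall x, (x \in S) = (x *m C == 0).
Proof.
case=> S0 Slin; pose A := \matrix_(i < #|S|) enum_val i : 'M[F]_(_, n).
exists (cokermx A) => x; rewrite -submxE; apply/idP/submxP => [Sx | [D ->]].
  exists (delta_mx 0 (enum_rank_in S0 x)).
  by rewrite -rowE rowK enum_rankK_in.
rewrite mulmx_sum_row; apply: (big_ind (fun v => v \in S)) => //.
  by move=> u v Su Sv; rewrite -[u]scale1r Slin.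
by move=> i _; rewrite rowK -[_ *: _]addr0 Slin ?enum_valP.
Qed.

(** The equations of a subspace of codimension at most 1, complemented by [v],
reduce to any one of them that does not vanish at [v]; if they all vanish at
[v], the subspace is everything and the zero form serves. *)
Lemma codim1_dot (F : finFieldType) n (S : {pred 'rV[F]_n}) v :
    GRing.submod_closed S -> (forall y, exists c, y - c *: v \in S) ->
  exists a, forall y, (y \in S) = (dot a y == 0).
Proof.
move=> SS Sv; have [C SC] := submod_kermx SS; have [S0 Slin] := SS.
have [vC0 | /rV0Pn[j vCj]] := eqVneq (v *m C) 0.
  exists 0 => y; rewrite dot0l eqxx SC; have [c] := Sv y.
  by rewrite SC mulmxBl -scalemxAl vC0 scaler0 subr0.
exists (row j C^T) => y; rewrite dot_row.
apply/idP/eqP => [| yCj]; first by rewrite SC => /eqP->; rewrite mxE.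
have [c Sy] := Sv y; move: (Sy); rewrite [_ - _ \in _]SC mulmxBl -scalemxAl subr_eq0.
move/eqP/rowP/(_ j); rewrite yCj mxE => /esym/eqP.
rewrite mulf_eq0 (negPf vCj) orbF => /eqP c0.
by rewrite c0 scale0r subr0 in Sy.
Qed.

(** The columns of the cokernel of the matrix with rows [u] and [v] are vectors
killed by [u] and [v]; as [w] kills them too, it is in the row space. *)
Lemma dot_dual (F : fieldType) n (u v w : 'rV[F]_n) :
    (forall y, dot u y = 0 -> dot v y = 0 -> dot w y = 0) ->
  exists a b, w = a *: u + b *: v.
Proof.
move=> uvw; pose A := col_mx u v.
have /submxP[D ->] : (w <= A)%MS.
  rewrite submxE; apply/eqP/rowP => j; rewrite [RHS]mxE -dot_row dotC.
  have AC : A *m cokermx A = 0 by rewrite mulmx_coker.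
  have E : forall t : 'rV[F]_n, t *m cokermx A = 0 -> dot t (row j (cokermx A)^T) = 0.
    by move=> t tA; rewrite dotC dot_row tA mxE.
  move/eqP: AC; rewrite mul_col_mx -col_mx0 => /eqP/eq_col_mx[uC vC].
  by apply: uvw; apply: E.
exists (lsubmx D 0 0), (rsubmx D 0 0).
rewrite -[D in LHS]hsubmxK mul_row_col.
by congr (_ + _); rewrite -mul_scalar_mx -mx11_scalar.
Qed.

(** * Families of forms with linear horizontal fibers *)

(** When a set of pairs is given by its vertical fibers, the one over [x] being
the kernel of the form [f x], this is the linearity of the horizontal fibers. *)
Definition transverse_forms (F : fieldType) n (f : 'rV[F]_n -> 'rV[F]_n) :=
  forall y, GRing.submod_closed [pred x | dot (f x) y == 0].

(** The fields with two or three elements, characterized by the only property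
of theirs on which the argument rests. *)
Definition pm1_field (F : fieldType) := forall c : F, c != 0 -> c = 1 \/ c = -1.

(** A vector [y] killed by [f x] and [f x'] has [x] and [x'] in its horizontal
fiber, hence also their combinations. *)
Lemma transverse_forms_span (F : fieldType) n (f : 'rV[F]_n -> 'rV[F]_n) a b x x' :
  transverse_forms f -> exists c d, f (a *: x + b *: x') = c *: f x + d *: f x'.
Proof.
move=> tf; apply: dot_dual => y xy x'y; have [/[!inE] y0 ylin] := tf y.
apply/eqP; apply: (ylin a x (b *: x')); rewrite ?inE ?xy //.
by rewrite -[_ *: _]addr0; apply: (ylin b x' 0); rewrite ?inE ?x'y.
Qed.

Lemma transverse_forms_line (F : fieldType) n (f : 'rV[F]_n -> 'rV[F]_n) a b x x'
    (w : 'rV[F]_n) :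
    transverse_forms f -> (f x <= w)%MS -> (f x' <= w)%MS ->
  (f (a *: x + b *: x')%R <= w)%MS.
Proof.
move=> tf xw x'w; have [c [d ->]] := transverse_forms_span a b x x' tf.
by rewrite addmx_sub ?scalemx_sub.
Qed.

Lemma transverse_formsZ (F : fieldType) n (f : 'rV[F]_n -> 'rV[F]_n) a x y :
  transverse_forms f -> a != 0 -> (dot (f (a *: x)) y == 0) = (dot (f x) y == 0).
Proof.
move=> tf a0; have [/[!inE] y0 ylin] := tf y.
have W c u : dot (f u) y == 0 -> dot (f (c *: u)) y == 0.
  by move=> uy; have := ylin c u 0; rewrite !inE addr0 => ->.
by apply/idP/idP => [/(W a^-1)|/W//]; rewrite scalerA mulVf // scale1r.
Qed.

Lemma pm1_add (F : fieldType) (c d : F) :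
  pm1_field F -> c != 0 -> d != 0 -> c + d != 0 -> c = d.
Proof. by move=> Fpm /Fpm[]-> /Fpm[]->; rewrite ?subrr ?addNr ?eqxx. Qed.

(** If [y] is killed neither at [x] nor at [x'], it is killed at [x + x'] or at
[x - x']. By independence [f (x + x')] and [f (x - x')] are combinations of
[f x] and [f x'] with nonzero coefficients, and as all scalars are signs there
is only one such combination up to a scalar, [w] below, that does not vanish at
[y]. If both were multiples of [w], so would be [f x]. *)
Lemma transverse_forms_meet (F : fieldType) n (f : 'rV[F]_n -> 'rV[F]_n) x x' y :
    pm1_field F -> transverse_forms f -> ~~ (f x' <= f x)%MS ->
    dot (f x) y != 0 -> dot (f x') y != 0 ->
  exists c, dot (f (x - c *: x')) y = 0.
Proof.
move=> Fpm tf ind ax ax'.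
have [p0|np] := eqVneq (dot (f (x + x')) y) 0.
  by exists (-1); rewrite scaleN1r opprK.
have [m0|nm] := eqVneq (dot (f (x - x')) y) 0.
  by exists 1; rewrite scale1r.
have fx0 : f x != 0 by apply: contra_neq ax => ->; rewrite dot0l.
have xx'0 : ~~ (f x <= f x')%MS.
  apply: contra ind => /sub_rVP[k fxE]; apply/sub_rVP; exists k^-1.
  rewrite fxE scalerA mulVf ?scale1r //; apply: contra_neq fx0 => k0.
  by rewrite fxE k0 scale0r.
(* The two terms of [w] take equal values at [y]; the other sign gives a form
   that vanishes there. *)
pose w := f x + (dot (f x) y / dot (f x') y) *: f x'.
have W e : e != 0 -> dot (f (x + e *: x')) y != 0 -> (f (x + e *: x')%R <= w)%MS.
  move=> e0; have [b [c]] := transverse_forms_span 1 e x x' tf.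
  rewrite scale1r => E; rewrite E dotDl !dotZl => nz.
  have c0 : c != 0.
    apply: contraNneq ind => c0; move: E; rewrite c0 scale0r addr0 => E.
    have -> : x' = e^-1 *: (x + e *: x') + - e^-1 *: x.
      by apply/rowP => i; rewrite !mxE; field.
    by apply: transverse_forms_line => //; apply/sub_rVP; exists b.
  have b0 : b != 0.
    apply: contraNneq xx'0 => b0; move: E; rewrite b0 scale0r add0r => E.
    have -> : x = 1 *: (x + e *: x') + - e *: x'.
      by apply/rowP => i; rewrite !mxE; field.
    by apply: transverse_forms_line => //; apply/sub_rVP; exists c.
  have bc : b * dot (f x) y = c * dot (f x') y by apply: pm1_add; rewrite ?mulf_neq0.
  apply/sub_rVP; exists b; rewrite scalerDr scalerA; congr (_ + _ *: _).
  by rewrite mulrA bc mulfK.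
have xpw : (f (x + x')%R <= w)%MS by rewrite -[x']scale1r W ?scale1r ?oner_eq0.
have xmw : (f (x - x')%R <= w)%MS by rewrite -scaleN1r W ?scaleN1r ?oppr_eq0 ?oner_eq0.
(* In characteristic 2 the form [w] vanishes at [y], and so does [f (x + x')]. *)
have two0 : 1 + 1 != 0 :> F.
  apply: contra_neq np => two0; have /sub_rVP[k ->] := xpw.
  rewrite dotZl dotDl dotZl divfK // -[dot _ _]mul1r -mulrDl two0.
  by rewrite mul0r mulr0.
have /sub_rVP[k fxE] : (f x <= w)%MS.
  have -> : x = (1 + 1)^-1 *: (x + x') + (1 + 1)^-1 *: (x - x').
    by apply/rowP => i; rewrite !mxE; field.
  exact: transverse_forms_line.
have k0 : k != 0 by apply: contra_neq fx0 => k0; rewrite fxE k0 scale0r.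
case/negP: ind; apply/sub_rVP.
exists (k^-1 * (1 - k) * (dot (f x') y / dot (f x) y)).
move/rowP: fxE => fxE; apply/rowP => i; have := fxE i; rewrite !mxE => E.
have -> : f x' 0 i = k^-1 * (dot (f x') y / dot (f x) y) *
    (k * (f x 0 i + dot (f x) y / dot (f x') y * f x' 0 i) - k * f x 0 i).
  by field; rewrite ?k0 ?ax ?ax'.
by rewrite -E; ring.
Qed.

(** Points with independent forms are covered by [transverse_forms_meet]. If [f x]
and [f x'] are proportional, that lemma brings both [x] and [x'] into the
horizontal fiber of [y] by subtracting multiples of one point [z] whose form is
off their line, and [z] is then eliminated. *)
Lemma transverse_forms_hyperplane (F : fieldType) n (f : 'rV[F]_n -> 'rV[F]_n) y :
    pm1_field F -> transverse_forms f -> (forall g : 'rV[F]_n, exists x, ~~ (f x <= g)%MS) ->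
  forall x x', dot (f x') y != 0 -> exists c, dot (f (x - c *: x')) y = 0.
Proof.
move=> Fpm tf notline x x' ax'.
have [x0|ax] := eqVneq (dot (f x) y) 0; first by exists 0; rewrite scale0r subr0.
have [par | ] := boolP (f x' <= f x)%MS; last by move=> ind; apply: transverse_forms_meet.
(* If [y] is killed at [z], it is not killed at [z + x], and the form there is
   still not proportional to [f x]. *)
have [z indz bz] : exists2 z, ~~ (f z <= f x)%MS & dot (f z) y != 0.
  have [z indz] := notline (f x); have [z0|] := eqVneq (dot (f z) y) 0; last by exists z.
  have zE : z = 1 *: (1 *: z + 1 *: x) + -1 *: x by apply/rowP => i; rewrite !mxE; ring.
  have xE : x = 1 *: (1 *: z + 1 *: x) + -1 *: z by apply/rowP => i; rewrite !mxE; ring.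
  exists (1 *: z + 1 *: x).
    by apply: contra indz => ?; rewrite zE; apply: transverse_forms_line.
  apply: contra_neq ax => s0; rewrite xE.
  have [c [d ->]] := transverse_forms_span 1 (-1) (1 *: z + 1 *: x) z tf.
  by rewrite dotDl !dotZl s0 z0 !mulr0 addr0.
have [c cE] := transverse_forms_meet Fpm tf indz ax bz.
have [|d dE] := transverse_forms_meet Fpm tf _ ax' bz.
  by apply: contra indz => /submx_trans->.
have d0 : d != 0 by apply: contra_neq ax' => d0; rewrite -dE d0 scale0r subr0.
exists (c / d).
have -> : x - (c / d) *: x' = 1 *: (x - c *: z) + (- (c / d)) *: (x' - d *: z).
  by apply/rowP => i; rewrite !mxE; field.
have [a [b ->]] := transverse_forms_span 1 (- (c / d)) (x - c *: z) (x' - d *: z) tf.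
by rewrite dotDl !dotZl cE dE !mulr0 addr0.
Qed.

(** In characteristic 2 signs are invisible. In characteristic 3, comparing
[N u] with [N (u - v)] and [N v], and then [N v] with [N u] and [N (u - v)],
shows that a wrong sign occurs only if [N u = N v], where it does no harm. *)
Lemma subr_morph_up_to_sign (F : fieldType) (U V : lmodType F)
    (S : {pred U}) (N : U -> V) :
    pm1_field F -> GRing.submod_closed S ->
    {in S &, forall u v, N (u - v) = N u - N v \/ N (u - v) = - (N u - N v)} ->
  {in S &, forall u v, N (u - v) = N u - N v}.
Proof.
move=> Fpm SS Npm; have [S0 Slin] := SS.
have SB : {in S &, forall u v, u - v \in S}.
  by move=> u v Su Sv; rewrite -scaleN1r addrC Slin.
have N0 : N 0 = 0 by have [] := Npm 0 0 S0 S0; rewrite !subrr ?oppr0.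
have [two0|two0] := eqVneq (1 + 1 : F) 0.
  have opp (v : V) : - v = v.
    by apply/eqP; rewrite -subr_eq0 -opprD oppr_eq0 -[v]scale1r -scalerDl two0 scale0r.
  by move=> u v Su Sv; have [//|->] := Npm u v Su Sv; rewrite opp.
(* The scalar 1 + 1 is then -1, as it cannot be 1. *)
have three0 : 1 + 1 + 1 = 0 :> F.
  have [/eqP|->] := Fpm _ two0; last by rewrite addNr.
  by rewrite -subr_eq0 addrK oner_eq0.
have tripV (v : V) : v + v = - v.
  apply/eqP; rewrite -subr_eq0 opprK.
  by rewrite -[v]scale1r -!scalerDl three0 scale0r.
have tripU (v : U) : v + v = - v.
  apply/eqP; rewrite -subr_eq0 opprK.
  by rewrite -[v]scale1r -!scalerDl three0 scale0r.
have NN u : u \in S -> N (- u) = - N u.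
  move=> Su; have Sn : - u \in S by rewrite -sub0r SB.
  have [] := Npm 0 u S0 Su; rewrite sub0r N0 sub0r ?opprK // => E.
  have := Npm u (- u) Su Sn; rewrite opprK tripU E subrr oppr0.
  by case=> ->; rewrite oppr0.
move=> u v Su Sv; have [//|E] := Npm u v Su Sv.
have Suv := SB u v Su Sv; have Snv : - v \in S by rewrite -sub0r SB.
have := Npm _ _ Suv Snv; rewrite opprK subrK NN // opprK E.
case=> /eqP Eu.
  suff -> : N u = N v by rewrite subrr oppr0.
  move: Eu; rewrite opprB addrAC (tripV (N v)) -opprD -addr_eq0 addrCA (tripV (N u)).
  by rewrite subr_eq0 => /eqP.
have Nv0 : N v = 0.
  move: Eu; rewrite opprB addrAC (tripV (N v)) opprD !opprK.
  by rewrite -subr_eq0 opprD addrCA subrr addr0 oppr_eq0 => /eqP.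
have := Npm u (u - v) Su Suv; rewrite opprB [in N _]addrC subrK E Nv0 subr0 opprK (tripV (N u)).
by case=> /esym/eqP; rewrite ?oppr_eq0 => /eqP->; rewrite oppr0.
Qed.

Lemma linear_mx (F : fieldType) m n (L : 'rV[F]_m -> 'rV[F]_n) :
    (forall a x y, L (a *: x + y) = a *: L x + L y) ->
  exists B, forall x, L x = x *m B.
Proof.
move=> Llin.
have L0 : L 0 = 0.
  by have := Llin (-1) 0 0; rewrite scaleN1r oppr0 addr0 scaleN1r addNr.
exists (\matrix_j L (delta_mx 0 j)) => x.
rewrite mulmx_sum_row {1}[x]row_sum_delta.
elim/big_rec2: _ => [//|i u v _ <-].
by rewrite rowK Llin.
Qed.

(** The horizontal fiber of [y0] is the hyperplane [S], the kernel of [a], and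
[z] spans a complement of it. The forms [f (m + z)] for [m] in [S] do not vanish
at [y0], and normalizing their value there removes the indeterminacy of their
scalar; the differences [N m] of normalized forms are the linear choice on
[S]. *)
Lemma transverse_forms_linear (F : fieldType) n (f : 'rV[F]_n -> 'rV[F]_n) y0 z a :
    pm1_field F -> transverse_forms f -> dot a z = 1 ->
    (forall x, (dot (f x) y0 == 0) = (dot a x == 0)) ->
  exists B : 'M_n, forall x y, (dot (f x) y == 0) = (dot (x *m B) y == 0).
Proof.
move=> Fpm tf az aE.
pose norm u := (dot u y0)^-1 *: u : 'rV[F]_n.
pose N m := norm (f (m + z)) - norm (f z).
pose S := [pred m | dot a m == 0].
have SS : GRing.submod_closed S.
  have [y00 ylin] := tf y0; split=> [|k u v]; first by rewrite inE -aE.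
  by rewrite !inE dotDr dotZr => /eqP-> /eqP->; rewrite mulr0 addr0.
have norm1 x : dot a x = 1 -> dot (norm (f x)) y0 = 1.
  by move=> ax; rewrite dotZl mulVf // aE ax oner_eq0.
have norm_eq0 x y : dot a x = 1 -> (dot (norm (f x)) y == 0) = (dot (f x) y == 0).
  by move=> ax; rewrite dotZl mulf_eq0 invr_eq0 aE ax oner_eq0.
have Sz m : m \in S -> dot a (m + z) = 1 by rewrite inE dotDr az => /eqP->; rewrite add0r.
(* The difference of two normalized forms vanishes at [y0], and it spans the
   combinations of these forms that do. *)
have fN m m' : m \in S -> m' \in S ->
    exists2 e, e != 0 & f (m - m') = e *: (N m - N m').
  move=> Sm Sm'; have Sd : m - m' \in S.
    by have [_ Slin] := SS; rewrite -scaleN1r addrC Slin.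
  have -> : N m - N m' = norm (f (m + z)) - norm (f (m' + z)) by rewrite /N opprB addrA subrK.
  have [b [c]] : exists b c, f (m - m') = b *: norm (f (m + z)) + c *: norm (f (m' + z)).
    have -> : m - m' = 1 *: (m + z) + -1 *: (m' + z).
      by apply/rowP => i; rewrite !mxE; ring.
    have [b [c ->]] := transverse_forms_span 1 (-1) (m + z) (m' + z) tf.
    exists (b * dot (f (m + z)) y0), (c * dot (f (m' + z)) y0).
    by rewrite /norm !scalerA !mulfK // aE Sz // oner_eq0.
  move=> E; have : dot (f (m - m')) y0 = 0 by apply/eqP; rewrite aE.
  rewrite E dotDl [dot (b *: _) _]dotZl [dot (c *: _) _]dotZl !norm1 ?Sz // !mulr1.
  move/eqP; rewrite addrC addr_eq0 => /eqP cE.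
  rewrite cE scaleNr -scalerBr; rewrite cE scaleNr -scalerBr in E.
  have [b0|b0] := eqVneq b 0; last by exists b.
  (* Here [f (m - m')] is zero, so the forms at [m + z] and [m' + z] are
     proportional, and equal after normalization. *)
  exists 1; rewrite ?oner_eq0 // scale1r b0 scale0r.
  have f0 : f (m - m') = 0 by rewrite E b0 scale0r.
  have [d] : exists d, f (m + z) = d *: f (m' + z).
    have -> : m + z = 1 *: (m - m') + 1 *: (m' + z).
      by apply/rowP => i; rewrite !mxE; ring.
    have [d [e ->]] := transverse_forms_span 1 1 (m - m') (m' + z) tf.
    by exists e; rewrite f0 scaler0 add0r.
  move=> fE; have := norm1 _ (Sz m Sm); have := norm1 _ (Sz m' Sm').
  rewrite /norm !dotZl => n1 n2; apply/eqP; rewrite eq_sym subr_eq0; apply/eqP.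
  rewrite {2}fE scalerA; congr (_ *: _).
  have := n2; rewrite [in X in _ * X]fE dotZl mulrA => n3.
  apply: (@mulIf _ (dot (f (m' + z)) y0)); first by rewrite aE Sz // oner_eq0.
  by rewrite n3 n1.
have S0 : 0 \in S by case: SS.
have N0 : N 0 = 0 by rewrite /N add0r subrr.
have fNm m : m \in S -> exists2 e, e != 0 & f m = e *: N m.
  by move=> Sm; have [e e0] := fN m 0 Sm S0; rewrite N0 !subr0; exists e.
have Nadd : {in S &, forall u v, N (u - v) = N u - N v}.
  apply: subr_morph_up_to_sign => // u v Su Sv.
  have Suv : u - v \in S by have [_ Slin] := SS; rewrite -scaleN1r addrC Slin.
  have [e e0 fE] := fN u v Su Sv; have [d d0] := fNm _ Suv; rewrite fE => E.
  have : N (u - v) = (d^-1 * e) *: (N u - N v) by rewrite -scalerA E scalerA mulVf // scale1r.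
  by case: (Fpm (d^-1 * e)) => [|->|->]; rewrite ?mulf_neq0 ?invr_eq0 // ?scale1r ?scaleN1r; auto.
have Nlin k : {in S &, forall u v, N (k *: u + v) = k *: N u + N v}.
  have Sopp u : u \in S -> - u \in S.
    by move=> Su; have [_ Slin] := SS; rewrite -scaleN1r -[_ *: _]addr0 Slin.
  have Nopp u : u \in S -> N (- u) = - N u.
    by move=> Su; rewrite -sub0r Nadd // N0 sub0r.
  move=> u v Su Sv; have [->|/Fpm[]->] := eqVneq k 0.
  - by rewrite !scale0r !add0r.
  - by rewrite !scale1r -[v in LHS]opprK Nadd ?Nopp ?opprK ?Sopp.
  - by rewrite !scaleN1r addrC Nadd // addrC.
pose L x := N (x - dot a x *: z) + dot a x *: norm (f z).
have [|B LB] := @linear_mx F n n L.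
  move=> k x y; rewrite /L.
  have Sx u : u - dot a u *: z \in S by rewrite inE dotBr dotZr az mulr1 subrr.
  have -> : k *: x + y - dot a (k *: x + y) *: z =
      k *: (x - dot a x *: z) + (y - dot a y *: z).
    by rewrite dotDr dotZr; apply/rowP => i; rewrite !mxE; ring.
  rewrite Nlin // dotDr dotZr.
  by apply/rowP => i; rewrite !mxE; ring.
exists B => x y; rewrite -LB.
(* On [S] the map [L] is [N]; a point outside [S] is a multiple of a point of
   [S + z], where [L] is the normalized form. *)
have [ax0|ax0] := eqVneq (dot a x) 0.
  rewrite /L ax0 !scale0r subr0 addr0.
  have [|e e0 ->] := fNm x; first by rewrite inE ax0.
  by rewrite dotZl mulf_eq0 (negPf e0).
pose x1 := (dot a x)^-1 *: x.
have ax1 : dot a x1 = 1 by rewrite dotZr mulVf.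
have -> : L x = dot a x *: norm (f x1).
  have -> : L x = dot a x *: L x1.
    by rewrite !LB /x1 -scalemxAl scalerA divff ?scale1r.
  by rewrite /L /N ax1 !scale1r subrK subrK.
by rewrite dotZl mulf_eq0 (negPf ax0) norm_eq0 // transverse_formsZ ?invr_eq0.
Qed.

(** Either all forms are proportional or the horizontal fibers have codimension
at most 1; a fiber that is not everything then provides [y0] and [z]. *)
Lemma transverse_forms_dichotomy (F : finFieldType) n (f : 'rV[F]_n -> 'rV[F]_n) :
    pm1_field F -> transverse_forms f ->
  (exists g : 'rV[F]_n, forall x, (f x <= g)%MS) \/
  (exists B : 'M_n, forall x y, (dot (f x) y == 0) = (dot (x *m B) y == 0)).
Proof.
move=> Fpm tf.
case: (boolP [exists g : 'rV_n, [forall x, (f x <= g)%MS]]) => [/existsP[g /forallP fg]|].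
  by left; exists g.
move=> /existsPn notline; right.
have {}notline (g : 'rV[F]_n) : exists x, ~~ (f x <= g)%MS by have /forallPn := notline g.
have [z nz] := notline 0.
have [y0 zy0] : exists y, dot (f z) y != 0.
  by apply: dot_nondegenerate; apply: contraNneq nz => ->; rewrite sub0mx.
have [a aE] := codim1_dot (v := z) (tf y0) (fun x =>
  let: ex_intro c E := transverse_forms_hyperplane Fpm tf notline x zy0 in
  ex_intro _ c (introT eqP E)).
have az0 : dot a z != 0 by rewrite -aE inE.
apply: (@transverse_forms_linear F n f y0 z ((dot a z)^-1 *: a)) => //.
  by rewrite dotZl mulVf.
by move=> x; rewrite dotZl mulf_eq0 invr_eq0 (negPf az0) -aE inE.
Qed.

(** The points [x] with [f x = 0] form a subspace with equations [x *m C = 0]; the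
forms required are the products of these equations with [g]. *)
Lemma transverse_forms_rank1 (F : finFieldType) n (f : 'rV[F]_n -> 'rV[F]_n) (g : 'rV[F]_n) :
    transverse_forms f -> (forall x, (f x <= g)%MS) ->
  exists B : 'I_n -> 'M_n, forall x y,
    (dot (f x) y == 0) = [forall i, dot (x *m B i) y == 0].
Proof.
move=> tf fg; have f0 : f 0 = 0.
  apply/eqP; apply: contraT => /dot_nondegenerate[y].
  by have [/[!inE] ->] := tf y.
have [|C CE] := @submod_kermx F n [pred x | f x == 0].
  split=> [|a x x']; rewrite !inE ?f0 // => /eqP fx0 /eqP fx'0.
  have [b [c]] := transverse_forms_span a 1 x x' tf.
  by rewrite scale1r => ->; rewrite fx0 fx'0 !scaler0 addr0.
exists (fun i => col i C *m g) => x y.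
have BE i : dot (x *m (col i C *m g)) y = (x *m C) 0 i * dot g y.
  rewrite mulmxA -dotZl; congr (dot _ y).
  rewrite colE mulmxA -colE [col i _]mx11_scalar mul_scalar_mx.
  by rewrite mxE.
under eq_forallb => i do rewrite BE.
have [g0|g0] := eqVneq (dot g y) 0.
  have /sub_rVP[c ->] := fg x; rewrite dotZl g0 mulr0 eqxx.
  by apply/esym/forallP => i; rewrite mulr0.
have [xC|] := eqVneq (x *m C) 0.
  have := CE x; rewrite xC inE eqxx => /eqP->; rewrite dot0l eqxx.
  by apply/esym/forallP => i; rewrite mxE mul0r.
move=> /[dup] xC /rV0Pn[i xCi]; have := CE x; rewrite inE (negPf xC) => fx0.
have /sub_rVP[c fxE] := fg x; rewrite fxE dotZl mulf_eq0 (negPf g0) orbF.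
have -> : (c == 0) = false by apply: contraFF fx0 => /eqP c0; rewrite fxE c0 scale0r.
apply/esym/forallP => /(_ i).
by rewrite mulf_eq0 (negPf xCi) (negPf g0).
Qed.

(** * Bilinear sets *)

Definition mxform (F : fieldType) m n (U : {vspace 'rV[F]_m}) (W : {vspace 'rV[F]_n})
  (B : 'M[F]_(m, n)) (x : subvs_of U) (y : subvs_of W) : F := dot (vsval x *m B) (vsval y).

Lemma mxform_bilinear (F : fieldType) m n (U : {vspace 'rV[F]_m}) (W : {vspace 'rV[F]_n}) B :
  bilinear_for *%R *%R (@mxform F m n U W B).
Proof.
split=> [y a x x' | x a y y']; rewrite /mxform linearP /=.
  by rewrite mulmxDl -scalemxAl dotDl dotZl.
by rewrite dotDr dotZr.
Qed.

HB.instance Definition _ (F : fieldType) m n (U : {vspace 'rV[F]_m})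
    (W : {vspace 'rV[F]_n}) B :=
  bilinear_isBilinear.Build F (subvs_of U) (subvs_of W) F *%R *%R (@mxform F m n U W B)
  (@mxform_bilinear F m n U W B).

Lemma bilinear_set_of_matrices p n (W : {vspace 'rV['F_p]_n}) r
    (B : 'I_r -> 'M['F_p]_n) (P : {set 'rV['F_p]_n * 'rV['F_p]_n}) :
    (forall x y, ((x, y) \in P) = (y \in W) && [forall i, dot (x *m B i) y == 0]) ->
  bilinear_set P.
Proof.
move=> PE; exists fullv, W, r.
exists (fun i => @mxform 'F_p n n fullv W (B i)).
apply/setP => -[x y]; rewrite PE !inE /= memvf /=.
case Wy: (y \in W) => //=; apply: eq_forallb => i.
by rewrite /mxform !vsprojK ?memvf.
Qed.

(** Over a prime field scalars are iterated sums, and 0 is a sum of [p] copies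
of [u]. *)
Lemma add_closed_submod p n (S : {pred 'rV['F_p]_n}) u :
    prime p -> u \in S -> {in S &, forall v w, v + w \in S} ->
  GRing.submod_closed S.
Proof.
move=> pp Su Sadd.
have SMn v k : v \in S -> v *+ k.+1 \in S.
  by move=> Sv; elim: k => // k IHk; rewrite mulrS Sadd.
have S0 : 0 \in S.
  have := SMn u p.-1 Su; rewrite prednK ?prime_gt0 // -scaler_nat.
  by rewrite pcharf0 ?pchar_Fp // scale0r.
split=> // a v w Sv Sw; apply: Sadd => //.
rewrite -[a]natr_Zp scaler_nat; case: (a : nat) => // k.
exact: SMn.
Qed.

Lemma hyperplane_complement p n (H : {vspace 'rV['F_p]_n}) :
  hyperplane H -> exists v, forall y, exists c, y - c *: v \in H.
Proof.
rewrite /hyperplane => dimH.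
have /subvPn[v _ nHv] : ~~ (fullv <= H)%VS.
  by apply/negP => /dimvS; rewrite -dimH addn1 ltnn.
exists v => y.
have : y \in (H + <[v]>)%VS.
  suff -> : (H + <[v]>)%VS = fullv by rewrite memvf.
  apply/eqP; rewrite eqEdim subvf -dimH addn1 /=.
  rewrite ltnNge; apply: contra nHv => le_dim.
  have /eqP HE : H == (H + <[v]>)%VS by rewrite eqEdim addvSl.
  by rewrite HE (subvP (addvSr H _)) ?memv_line.
case/memv_addP => h Hh [w /vlineP[c ->] ->].
by exists c; rewrite addrK.
Qed.

(** The vertical fibers are turned into forms, and horizontal closure tells
whether they satisfy [transverse_forms]: they do exactly when the fiber over 0
is everything. *)
Lemma bilinear_of_hyperplane_fibers p n (P : {set 'rV['F_p]_n * 'rV['F_p]_n}) :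
    prime p -> pm1_field 'F_p -> transverse P ->
    (forall x, exists2 H : {vspace 'rV['F_p]_n},
       hyperplane H & {subset H <= vertical_fiber P x}) ->
  bilinear_set P.
Proof.
move=> pp Fpm [PV PH] P_fibers.
have addV x : {in [pred y | (x, y) \in P] &, forall y y', y + y' \in [pred y | (x, y) \in P]}.
  move=> y y'; rewrite !inE => Py Py'; rewrite -PV /vertical_sum.
  by apply/imset2P; exists (x, y) (x, y'); rewrite ?inE ?Py' ?eqxx.
have addH y : {in [pred x | (x, y) \in P] &, forall x x', x + x' \in [pred x | (x, y) \in P]}.
  move=> x x'; rewrite !inE => Px Px'; rewrite -PH /horizontal_sum.
  by apply/imset2P; exists (x, y) (x', y); rewrite ?inE ?Px' ?eqxx.
have subH y x : (x, y) \in P -> GRing.submod_closed [pred x | (x, y) \in P].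
  by move=> Pxy; apply: (add_closed_submod pp _ (addH y)); exact: Pxy.
have [f fE] : exists f : 'rV['F_p]_n -> 'rV['F_p]_n,
    forall x y, ((x, y) \in P) = (dot (f x) y == 0).
  suff /fin_all_exists[f fE] : forall x, exists a, forall y, ((x, y) \in P) = (dot a y == 0).
    by exists f.
  move=> x; have [H /hyperplane_complement[v Hv] HP] := P_fibers x.
  have HP' y : y \in H -> (x, y) \in P by move=> /HP; rewrite inE.
  apply: (@codim1_dot 'F_p n [pred y | (x, y) \in P] v) => [|y].
    apply: (@add_closed_submod p n _ 0 pp _ (addV x)).
    by rewrite inE HP' ?mem0v.
  by have [c Hc] := Hv y; exists c; rewrite inE HP'.
have [/forallP P0 | /forallPn[y1 Py1]] := boolP [forall y, (0, y) \in P].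
  have tf : transverse_forms f.
    move=> y; have [S0 Slin] := subH y 0 (P0 y).
    by split=> [|a x x']; rewrite !inE -!fE //; apply: Slin.
  have [[g fg] | [B BE]] := transverse_forms_dichotomy Fpm tf.
    have [B BE] := transverse_forms_rank1 tf fg.
    apply: (@bilinear_set_of_matrices p n fullv n B) => x y.
    by rewrite memvf fE BE.
  apply: (@bilinear_set_of_matrices p n fullv 1 (fun _ => B)) => x y.
  rewrite memvf fE BE; apply/idP/forallP => [xy //|/(_ 0)//].
(* A point [y1] outside the fiber over 0 has an empty horizontal fiber. All
   forms are then nonzero multiples of [f 0]. *)
pose W := lker (linfun (mulmxr (f 0)^T : 'rV['F_p]_n -> 'rV['F_p]_1)).
apply: (@bilinear_set_of_matrices p n W 0 (fun _ => 0)) => x y.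
have -> : (y \in W) = ((0, y) \in P).
  by rewrite memv_ker lfunE /= fE dotC dot_eq0.
have -> : [forall i : 'I_0, dot (x *m 0) y == 0] by apply/forallP => -[].
rewrite andbT.
have P0 y' : (x, y') \in P -> (0, y') \in P by move=> /subH[].
apply/idP/idP => [/P0//|].
have [|a [b f0E]] := @dot_dual 'F_p n (f x) (f x) (f 0).
  by move=> y' /eqP xy' _; apply/eqP; rewrite -fE P0 ?fE.
rewrite !fE f0E -scalerDl dotZl mulf_eq0 => /orP[ab0|//].
by move: Py1; rewrite fE f0E -scalerDl (eqP ab0) scale0r dot0l eqxx.
Qed.

Local Close Scope ring_scope.

Theorem theorem1p4 (p n : nat) (hp : p = 2 \/ p = 3) (hn : 0 < n)
    (P : {set 'rV['F_p]_n * 'rV['F_p]_n})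
    (P_transverse : transverse P)
    (P_fibers : forall x : 'rV['F_p]_n, exists2 H : {vspace 'rV['F_p]_n},
       hyperplane H & {subset H <= vertical_fiber P x}) :
  bilinear_set P.
Proof.
have pp : prime p by case: hp => ->.
have Fpm : pm1_field 'F_p.
  by case: hp => ->; case=> [[|[|[|]]]] //= i _; [left|left|right]; apply/val_inj.
exact: bilinear_of_hyperplane_fibers.
Qed.
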